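(* Let $S$ be the curve $y(y^2+x)(y^2-x)=0$. Its local braid monodromy at $(0,0)$ is a $180^\circ$ counterclockwise rotation of the four points $y=1,-1,i,-i$ of the fiber over $x=1$ around the point $y=0$, which stays fixed; that is, it is the braid induced by the motion $y\mapsto e^{\pi i t}y$, $0\le t\le 1$, of the set $\{0,1,-1,i,-i\}$.
   Context: Let $E=\{x\in\mathbb{C}:|x|\le 1\}$, $D=\{y\in\mathbb{C}:|y|\le 4\}$, and regard $S$ as a curve in $E\times D$. The projection of $S$ to $E$ has fibers of constant cardinality $n=5$ except over $x=0$. Let $K\subset D$ be the set of $y$-coordinates of the points of $S$ over $x=1$, and let $u_0=-4i$. A motion of $K$ in $D$ consists of $n$ continuous functions $m_i:[0,1]\to D$ with $m_i(t)\ne m_j(t)$ for all $t$ and $i\neq j$, and $\{m_i(0)\}=\{m_i(1)\}=K$. It is realized by a continuous family of diffeomorphisms $D_t$ of $D$, $D_0=\mathrm{Id}$, equal to the identity on $\partial D$, with $D_t(m_i(0))=m_i(t)$; the braid induced by the motion is the class of $D_1$ in the braid group $B_n[D,K]$, the group of diffeomorphisms of $D$ preserving $K$ and equal to the identity on $\partial D$, two being identified if they induce the same automorphism of $\pi_1(D-K,u_0)$. The local braid monodromy of $S$ at $(0,0)$ is the braid induced by the motion formed by the points of $S$ over $x=e^{2\pi i t}$, $0\le t\le 1$. *)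

(* Defs.v *)
From HB Require Import structures.
From mathcomp Require Import all_boot all_order all_algebra.
From mathcomp Require Import generic_quotient complex.
From mathcomp Require Import all_classical all_reals all_analysis.

Set Implicit Arguments.
Unset Strict Implicit.
Unset Printing Implicit Defensive.

Import Order.TTheory GRing.Theory Num.Theory.
Import numFieldNormedType.Exports.

Local Open Scope classical_set_scope.
Local Open Scope ring_scope.
Local Open Scope quotient_scope.
Local Open Scope complex_scope.

(* The usual topology of the complex plane, i.e. the one of the norm `|z|. *)
HB.instance Definition _ (R : realType) := NormedModule.copy R[i] R[i]^o.

Lemma within_comp (T U V : topologicalType) (A : set T) (B : set U)
    (f : T -> U) (g : U -> V) :
  {within A, continuous f} -> (forall x, A x -> B (f x)) ->
  {within B, continuous g} -> {within A, continuous (g \o f)}.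
Proof.
move=> /subspace_continuousP cf fAB /subspace_continuousP cg.
apply/subspace_continuousP => x Ax W /(cg _ (fAB _ Ax)) hW.
have := cf x Ax _ hW; rewrite /nbhs /= /within /=.
apply: filter_app; near=> y => h Ay; exact: h Ay (fAB _ Ay).
Unshelve. all: by end_near.
Qed.

Lemma pair_continuous (T U V : topologicalType) (f : T -> U) (g : T -> V) :
  continuous f -> continuous g -> continuous (fun x => (f x, g x)).
Proof. by move=> cf cg x; apply: (cvg_pair (cf x) (cg x)). Qed.

Section FundamentalGroup.
Context {R : realType} {T : topologicalType} (A : set T) (x0 : T).

Notation I := `[(0:R), 1]%classic.

(* Only the values on [0, 1] of a loop matter: two loops that agree there are
   homotopic. *)
Record loop := Loop {
  loop_fun :> R -> T;
  loop_cts : {within I, continuous loop_fun};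
  loop_sub : forall t, I t -> A (loop_fun t);
  loop_at0 : loop_fun 0 = x0;
  loop_at1 : loop_fun 1 = x0 }.

HB.instance Definition _ := gen_eqMixin loop.
HB.instance Definition _ := gen_choiceMixin loop.

Definition is_homotopy (a b : loop) (H : R * R -> T) : Prop :=
  [/\ {within I `*` I, continuous H},
      forall s t, I s -> I t -> A (H (s, t)),
      forall t, I t -> H (0, t) = a t,
      forall t, I t -> H (1, t) = b t &
      forall s, I s -> H (s, 0) = x0 /\ H (s, 1) = x0].

Definition homotopic : rel loop := fun a b => `[< exists H, is_homotopy a b H >].

Lemma homotopic_refl : reflexive homotopic.
Proof.
move=> a; apply/asboolP; exists (a \o snd); split => //=.
- apply: (@within_comp _ _ _ _ I); last exact: loop_cts.
    by apply: continuous_subspaceT => p; exact: cvg_snd.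
  by move=> [s t] [].
- by move=> s t _; exact: loop_sub.
- by move=> s _; rewrite loop_at0 loop_at1.
Qed.

Lemma homotopic_sym_imp a b : homotopic a b -> homotopic b a.
Proof.
move=> /asboolP[H [cH HA H0 H1 Hx]]; apply/asboolP.
have I1 s : I s -> I (1 - s).
  by rewrite /= !in_itv /= subr_ge0 lerBlDr lerDl andbC.
exists (H \o (fun p : R * R => (1 - p.1, p.2))); split => //=.
- apply: within_comp cH.
    apply: continuous_subspaceT; apply: pair_continuous => p.
      by apply: cvgB; [exact: cvg_cst|exact: cvg_fst].
    exact: cvg_snd.
  by move=> [s t] [Is It]; split => //=; exact: I1.
- by move=> s t Is It; apply: HA => //; exact: I1.
- by move=> t It; rewrite subr0 H1.
- by move=> t It; rewrite subrr H0.
- by move=> s Is; apply: Hx; exact: I1.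
Qed.

Lemma homotopic_sym : symmetric homotopic.
Proof. by move=> a b; apply/idP/idP; exact: homotopic_sym_imp. Qed.

Lemma homotopic_trans : transitive homotopic.
Proof.
move=> b a c /asboolP[H [cH HA H0 H1 Hx]] /asboolP[G [cG GA G0 G1 Gx]].
apply/asboolP.
pose L := `[(0:R), 2^-1]%classic; pose U := `[(2^-1:R), 1]%classic.
have I_L s : L s -> I (s *+ 2).
  rewrite /L /= !in_itv /= => /andP[s0 s1]; rewrite mulrn_wge0 //=.
  by rewrite -mulr_natr -ler_pdivlMr // mul1r.
have I_U s : U s -> I (s *+ 2 - 1).
  rewrite /U /= !in_itv /= => /andP[s0 s1].
  rewrite subr_ge0 -mulr_natr -ler_pdivrMr // mul1r s0 /=.
  by rewrite lerBlDr mulr_natr mulr2n lerD.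
have IE : I = L `|` U.
  apply/seteqP; split=> s; rewrite /L /U /= !in_itv /=.
    by case: (leP s 2^-1) => [s2 /andP[-> _]|/ltW s2 /andP[_ ->]];
      [left|right; rewrite s2].
  case=> /andP[s0 s1]; first by rewrite s0 (le_trans s1) // invf_le1 // ler1n.
  by rewrite s1 (le_trans _ s0).
pose F (p : R * R) := if p.1 <= 2^-1 then H (p.1 *+ 2, p.2)
                      else G (p.1 *+ 2 - 1, p.2).
have half2 : 2^-1 *+ 2 = 1 :> R by rewrite -[LHS]mulr_natr mulVf ?pnatr_eq0.
have FH s t : L s -> F (s, t) = H (s *+ 2, t).
  by rewrite /F /L /= in_itv /= => /andP[_ ->].
have FG s t : U s -> I t -> F (s, t) = G (s *+ 2 - 1, t).
  rewrite /U /= in_itv /= => /andP[s0 _] It; rewrite /F /=.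
  case: ifPn => // s1.
  have -> : s = 2^-1 by apply/le_anti; rewrite s0 s1.
  by rewrite half2 subrr H1 // G0.
have clos (u v : R) : closed (`[u, v]%classic `*` I).
  have -> : `[u, v]%classic `*` I =
      (fst @^-1` `[u, v]%classic) `&` (snd @^-1` I) by [].
  apply: closedI; apply: preimage_closed; try exact: itv_closed.
    by move=> p _; exact: cvg_fst.
  by move=> p _; exact: cvg_snd.
exists F; split.
- have -> : I `*` I = (L `*` I) `|` (U `*` I).
    have Isub s : I s <-> L s \/ U s by rewrite IE.
    apply/seteqP; split=> -[s t].
      by move=> [/= /Isub[]]; [left|right].
    by move=> [[/= Ls It]|[/= Us It]]; split => //; apply/Isub; [left|right].
  apply: withinU_continuous; [exact: clos|exact: clos| |].
  + apply: (@subspace_eq_continuous _ _ _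
      (H \o (fun p : R * R => (p.1 *+ 2, p.2)))).
      by move=> [s t] /set_mem[/= Ls _]; exact/esym/FH.
    apply: within_comp cH; last by move=> [s t] [/= /I_L].
    apply: continuous_subspaceT; apply: pair_continuous => p.
      by apply: cvgMn; exact: cvg_fst.
    exact: cvg_snd.
  + apply: (@subspace_eq_continuous _ _ _
      (G \o (fun p : R * R => (p.1 *+ 2 - 1, p.2)))).
      by move=> [s t] /set_mem[/= Us It]; exact/esym/FG.
    apply: within_comp cG; last by move=> [s t] [/= /I_U].
    apply: continuous_subspaceT; apply: pair_continuous => p.
      by apply: cvgB; [apply: cvgMn; exact: cvg_fst|exact: cvg_cst].
    exact: cvg_snd.
- move=> s t; rewrite {1}IE => -[] Js It.
    by rewrite FH //; apply: HA => //; exact: I_L.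
  by rewrite FG //; apply: GA => //; exact: I_U.
- move=> t It; rewrite FH ?mul0rn ?H0 //.
  by rewrite /L /= in_itv /= lexx invr_ge0 ler0n.
- move=> t It; rewrite FG //.
    by rewrite mulr2n addrK G1.
  by rewrite /U /= in_itv /= lexx invf_le1 ?ler1n.
- have [I0 I1] : I 0 /\ I 1 by rewrite /= !in_itv /= !lexx ler01.
  move=> s; rewrite {1}IE => -[] Js.
    by rewrite !FH //; apply: Hx; exact: I_L.
  by rewrite !FG //; apply: Gx; exact: I_U.
Qed.

Canonical homotopic_equiv :=
  EquivRel homotopic homotopic_refl homotopic_sym homotopic_trans.

Definition pi1 := {eq_quot homotopic_equiv}.

End FundamentalGroup.

Arguments loop R {T} A x0.
Arguments pi1 R {T} A x0.

Section ComplexContinuity.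
Context {R : realType}.

Lemma Re_continuous : continuous (fun z : R[i] => complex.Re z).
Proof.
move=> w; apply/(@cvgrPdist_lt _ _ _ (nbhs w)) => e e0.
have e0' : 0 < e%:C by rewrite ltcR.
apply: filterS (nbhsx_ballx w _ e0') => z; rewrite -ball_normE /= => wz.
rewrite -ltcR; apply: le_lt_trans wz; apply: le_trans (normc_ge_Re _).
by rewrite raddfB.
Qed.

Lemma Im_continuous : continuous (fun z : R[i] => complex.Im z).
Proof.
move=> w; apply/(@cvgrPdist_lt _ _ _ (nbhs w)) => e e0.
have e0' : 0 < e%:C by rewrite ltcR.
apply: filterS (nbhsx_ballx w _ e0') => z; rewrite -ball_normE /= => wz.
rewrite -ltcR; apply: le_lt_trans wz.
have -> : `|w - z| = `|(w - z) * 'i| by rewrite normrM normCi mulr1.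
apply: le_trans (normc_ge_Re _).
by rewrite -complexiE ReiNIm raddfB normrN.
Qed.

Lemma complex_continuous : continuous (fun p : R * R => p.1 +i* p.2).
Proof.
move=> p; apply/(@cvgrPdist_lt _ _ _ (nbhs p)) => e.
case: e => r s; rewrite ltcE /= => /andP[/eqP -> r0].
have r2 : 0 < r / 2 by rewrite divr_gt0.
have h1 : \forall q \near p, `|p.1 - q.1| < r / 2.
  by apply: (@cvgr_dist_lt _ _ _ (nbhs p) _ fst p.1 _ _ r2); exact: cvg_fst.
have h2 : \forall q \near p, `|p.2 - q.2| < r / 2.
  by apply: (@cvgr_dist_lt _ _ _ (nbhs p) _ snd p.2 _ _ r2); exact: cvg_snd.
apply: filterS2 h1 h2 => q q1 q2.
have -> : p.1 +i* p.2 - q.1 +i* q.2 = (p.1 - q.1)%:C + 'i%C * (p.2 - q.2)%:C.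
  by apply/eqP; rewrite eq_complex /= !(mul0r, mul1r, subr0, addr0, add0r) !eqxx.
apply: le_lt_trans (ler_normD _ _) _.
rewrite normrM complexiE normCi mul1r !normc_def /= !expr0n /= !addr0 !sqrtr_sqr.
by rewrite -raddfD ltcR (splitr r) ltrD.
Qed.

End ComplexContinuity.

Section Smooth.
Context {R : realType}.

Fixpoint Ck (V W : normedModType R) (k : nat) (f : V -> W) : Prop :=
  if k is k'.+1 then
    (forall x, differentiable f x) /\ (forall v, Ck k' (fun x => 'D_v f x))
  else continuous f.

Definition real_coords (f : R[i] -> R[i]) (p : R * R) : R * R :=
  (complex.Re (f (p.1 +i* p.2)), complex.Im (f (p.1 +i* p.2))).

(* Smooth up to the boundary: f extends to a real-C^oo map of the plane. *)
Definition smooth_on (D : set R[i]) (f : R[i] -> R[i]) : Prop :=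
  exists2 g, forall k, Ck k (real_coords g) & {in D, f =1 g}.

Definition diffeo (D : set R[i]) (f : R[i] -> R[i]) : Prop :=
  [/\ set_bij D D f, smooth_on D f
    & exists2 g, smooth_on D g & {in D, cancel f g}].

End Smooth.


Section BraidGroup.
Context {R : realType}.
Notation C := R[i].
Notation I := `[(0:R), 1]%classic.

Definition disk : set C := [set y | `|y| <= 4].
Definition disk_boundary : set C := [set y | `|y| = 4].
Definition u0 : C := - 4 * 'i.

Variable K : set C.

(* A map that is a bijection of the disk preserves K when y is in K iff its
   image is; for K contained in the disk this says that K is mapped onto K. *)
Record braid_diffeo := BraidDiffeo {
  braid_fun :> C -> C;
  braid_fun_diffeo : diffeo disk braid_fun;
  braid_fun_K : forall y, disk y -> K (braid_fun y) <-> K y;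
  braid_fun_boundary : {in disk_boundary, braid_fun =1 id} }.

HB.instance Definition _ := gen_eqMixin braid_diffeo.
HB.instance Definition _ := gen_choiceMixin braid_diffeo.

Notation P := (pi1 R (disk `\` K) u0).

Lemma braid_within_continuous (beta : braid_diffeo) :
  {within disk, continuous beta}.
Proof.
have [_ [g gC gE] _] := braid_fun_diffeo beta.
apply: (@subspace_eq_continuous _ _ _ g).
  by move=> y yD; exact/esym/gE.
apply: continuous_subspaceT.
have := gC 0%N; rewrite /= => cg.
have -> : g = (fun p : R * R => p.1 +i* p.2) \o real_coords g \o
              (fun z => (complex.Re z, complex.Im z)).
  apply/funext => -[a b] /=; rewrite /real_coords /=.
  by case: (g _).
move=> z; apply: continuous_comp.
  by apply: pair_continuous; [exact: Re_continuous|exact: Im_continuous].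
by apply: continuous_comp; [exact: cg|exact: complex_continuous].
Qed.

Lemma braid_sub (beta : braid_diffeo) y :
  (disk `\` K) y -> (disk `\` K) (beta y).
Proof.
have [[bD _ _] _ _] := braid_fun_diffeo beta.
by move=> [Dy Ky]; split; [exact: bD|rewrite braid_fun_K].
Qed.

Lemma braid_u0 (beta : braid_diffeo) : beta u0 = u0.
Proof.
apply: braid_fun_boundary; apply/mem_set.
by rewrite /disk_boundary /u0 /= normrM normrN normr_nat normCi mulr1.
Qed.

Section Push.
Variables (beta : braid_diffeo) (gamma : loop R (disk `\` K) u0).

Lemma push_cts : {within I, continuous (beta \o gamma)}.
Proof.
apply: (@within_comp _ _ _ _ disk); first exact: loop_cts.
  by move=> t /(loop_sub gamma)[].
exact: braid_within_continuous.
Qed.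

Lemma push_sub t : I t -> (disk `\` K) ((beta \o gamma) t).
Proof. by move=> It; apply: braid_sub; exact: loop_sub. Qed.

Lemma push_at0 : (beta \o gamma) 0 = u0.
Proof. by rewrite /= loop_at0 braid_u0. Qed.

Lemma push_at1 : (beta \o gamma) 1 = u0.
Proof. by rewrite /= loop_at1 braid_u0. Qed.

Definition push := Loop push_cts push_sub push_at0 push_at1.

End Push.

Definition pi1_map (beta : braid_diffeo) (c : P) : P :=
  \pi_P (push beta (repr c)).

Lemma pi1_mapE beta gamma : pi1_map beta (\pi_P gamma) = \pi_P (push beta gamma).
Proof.
rewrite /pi1_map; apply/eqmodP => /=.
have /eqmodP/asboolP[H [cH HA H0 H1 Hx]] : \pi_P (repr (\pi_P gamma)) = \pi_P gamma.
  exact: reprK.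
apply/asboolP; exists (beta \o H); split => /=.
- apply: (@within_comp _ _ _ _ disk); first exact: cH.
    by move=> [s t] [/= Is It]; have [] := HA s t Is It.
  exact: braid_within_continuous.
- by move=> s t Is It; apply: braid_sub; exact: HA.
- by move=> t It; rewrite H0.
- by move=> t It; rewrite H1.
- by move=> s Is; have [-> ->] := Hx s Is; rewrite braid_u0.
Qed.

Definition same_braid : rel braid_diffeo :=
  fun b1 b2 => `[< pi1_map b1 = pi1_map b2 >].

Lemma same_braid_refl : reflexive same_braid.
Proof. by move=> b; apply/asboolP. Qed.

Lemma same_braid_sym : symmetric same_braid.
Proof. by move=> b1 b2; apply/asboolP/asboolP => ->. Qed.

Lemma same_braid_trans : transitive same_braid.
Proof.
by move=> b2 b1 b3 /asboolP e12 /asboolP e23; apply/asboolP; rewrite e12.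
Qed.

Canonical same_braid_equiv :=
  EquivRel same_braid same_braid_refl same_braid_sym same_braid_trans.

Definition braid := {eq_quot same_braid_equiv}.

Definition is_motion (n : nat) (m : 'I_n -> R -> C) : Prop :=
  [/\ forall i, {within I, continuous (m i)},
      forall i t, I t -> disk (m i t),
      forall t, I t -> injective (m^~ t),
      range (m^~ 0) = K & range (m^~ 1) = K].

Definition realizes (n : nat) (m : 'I_n -> R -> C) (Dt : R -> C -> C) : Prop :=
  [/\ forall t, I t -> diffeo disk (Dt t) /\ {in disk_boundary, Dt t =1 id},
      {within I `*` disk, continuous (fun p : R * C => Dt p.1 p.2)},
      {in disk, Dt 0 =1 id} &
      forall i t, I t -> Dt t (m i 0) = m i t].

Definition induced_braid (n : nat) (m : 'I_n -> R -> C) (b : braid) : Prop :=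
  is_motion m /\
  exists (Dt : R -> C -> C) (beta : braid_diffeo),
    [/\ realizes m Dt, Dt 1 = beta & b = \pi_braid beta].

End BraidGroup.

Arguments braid R K : clear implicits.

Section LocalMonodromy.
Context {R : realType}.
Notation C := R[i].
Notation I := `[(0:R), 1]%classic.

Definition cis (theta : R) : C := cos theta +i* sin theta.

Definition fiber (S : set (C * C)) (x : C) : set C := [set y | S (x, y)].

(* The m i are the n points of S over x = exp (2 pi i t), followed
   continuously in t; the order in which they are listed is immaterial. *)
Definition local_braid_monodromy (n : nat) (S : set (C * C))
    (b : braid R (fiber S 1)) : Prop :=
  exists2 m : 'I_n -> R -> C,
    forall t, I t -> range (m^~ t) = fiber S (cis (2 * pi * t)) &
    induced_braid m b.

Definition curve : set (C * C) :=
  [set z | [/\ `|z.1| <= 1, `|z.2| <= 4 &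
    z.2 * (z.2 ^+ 2 + z.1) * (z.2 ^+ 2 - z.1) = 0]].

Definition half_turn (i : 'I_5) (t : R) : C :=
  cis (pi * t) * [tuple 0; 1; -1; 'i; - 'i]`_i.

End LocalMonodromy.

Arguments local_braid_monodromy {R} n S b.
Arguments curve {R}.
Arguments half_turn {R} i t.

(* Main.v *)
Require Import Defs.
From mathcomp Require Import all_boot all_order all_algebra.
From mathcomp Require Import generic_quotient complex.
From mathcomp Require Import ring lra.
From mathcomp Require Import all_classical all_reals all_analysis.
Local Open Scope complex_scope.

Set Implicit Arguments.
Unset Strict Implicit.
Unset Printing Implicit Defensive.

Import Order.TTheory GRing.Theory Num.Theory.
Import numFieldNormedType.Exports.

(** The substitution x = exp (2 pi i t) makes the curve split: its points over x
    are 0 and the four square roots of x and - x, that is exp (pi i t) times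
    0, 1, -1, i, - i (half_turn_range).  So every motion formed by the points of
    the curve has, at each time, the same set of positions as the half turn.

    That is enough to determine the braid (same_trace_same_braid).  Let D_t and
    D'_t realize two motions that occupy the same set K_t at each time t.  Both
    D_t and D'_t map K onto K_t, so D'_t^-1 D_t preserves K, fixes the boundary
    circle, and joins the identity to D'_1^-1 D_1.  Applied to a loop in D - K it
    is a based homotopy inside D - K, whence D'_1^-1 D_1 acts trivially on
    pi_1 (D - K, u_0).

    It remains to realize the half turn.  The twist

      y |-> exp (pi i t (16 - |y|^2) / 15) y

    turns each circle |y| = r rigidly: by the angle pi t for r = 1, where the
    four moving points lie, and not at all for r = 4.  It fixes 0, it is real
    analytic, and its inverse is the twist with parameter - t, hence also
    analytic.  Each local monodromy and each braid induced by the half turn is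
    therefore the class of the twist at t = 1. *)

(** * Closure properties of the class C^k *)

Section CkCalculus.
Local Open Scope classical_set_scope.
Local Open Scope ring_scope.
Context {R : realType} {V : normedModType R}.
Implicit Types (f g : V -> R) (k : nat).

Lemma Ck_le (W : normedModType R) k (f : V -> W) : Ck k.+1 f -> Ck k f.
Proof.
elim: k f => [|k IH] f [df Df].
  by move=> x; exact/differentiable_continuous/df.
by split=> // v; apply: IH; exact: Df.
Qed.

Lemma Ck_cst k (c : R) : Ck k (fun _ : V => c : R^o).
Proof.
elim: k c => [|k IH] c; first by move=> x; exact: cvg_cst.
split; first by move=> x; exact: differentiable_cst.
move=> v; have -> : (fun x : V => 'D_v (fun=> c : R^o) x) = fun=> 0.
  by apply/funext => x; exact: derive_cst.
exact: IH.
Qed.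

Lemma Ck_linear k (f : {linear V -> R^o}) : continuous f -> Ck k f.
Proof.
move=> cf; case: k => [|k]; first exact: cf.
split=> [x|v]; first exact: linear_differentiable.
have -> : (fun x : V => 'D_v f x) = fun=> f v.
  by apply/funext => x; rewrite deriveE ?diff_lin//; exact: linear_differentiable.
exact: Ck_cst.
Qed.

Lemma Ck_add k (f g : V -> R^o) : Ck k f -> Ck k g -> Ck k (fun x => f x + g x).
Proof.
elim: k f g => [|k IH] f g; first by move=> cf cg x; exact: cvgD (cf x) (cg x).
move=> [df Df] [dg Dg]; split=> [x|v]; first exact: differentiableD.
have -> : (fun x => 'D_v (fun x => f x + g x) x) =
          fun x => 'D_v f x + 'D_v g x.
  by apply/funext => x; rewrite [LHS]deriveD//; exact: diff_derivable.
by apply: IH; [exact: Df|exact: Dg].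
Qed.

Lemma Ck_mul k (f g : V -> R^o) : Ck k f -> Ck k g -> Ck k (fun x => f x * g x).
Proof.
elim: k f g => [|k IH] f g; first by move=> cf cg x; exact: cvgM (cf x) (cg x).
move=> Cf Cg; have [df Df] := Cf; have [dg Dg] := Cg.
split=> [x|v]; first exact: differentiableM.
have -> : (fun x => 'D_v (fun x => f x * g x) x) =
          fun x => f x * 'D_v g x + g x * 'D_v f x.
  by apply/funext => x; rewrite [LHS]deriveM//; exact: diff_derivable.
by apply: Ck_add; apply: IH; [exact: Ck_le|exact: Dg|exact: Ck_le|exact: Df].
Qed.

(** The chain rule for an outer function of one real variable. *)
Lemma derive_comp_real (h : R -> R) (h' : R) (f : V -> R^o) x v :
  differentiable f x -> is_derive (f x) 1 h h' ->
  differentiable (h \o f : V -> R^o) x /\ 'D_v (h \o f : V -> R^o) x = h' * 'D_v f x.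
Proof.
move=> df dh.
have Dh : differentiable (h : R^o -> R^o) (f x).
  by apply/derivable1_diffP; exact: ex_derive.
split; first exact: differentiable_comp.
rewrite deriveE; last exact: differentiable_comp.
have dh1 : 'd (h : R^o -> R^o) (f x) 1 = h' by rewrite -deriveE//; exact: derive_val.
rewrite diff_comp//= deriveE// -dh1 mulrC -[LHS]/('d (h : R^o -> R^o) (f x) _).
by rewrite -[X in 'd _ _ X = _]mulr1 [LHS]linearZ.
Qed.

(** Cosine and sine are treated together since each is, up to sign, the
    derivative of the other. *)
Lemma Ck_cos_sin k (f : V -> R^o) :
  Ck k f -> Ck k (fun x => cos (f x) : R^o) /\ Ck k (fun x => sin (f x) : R^o).
Proof.
elim: k f => [|k IH] f.
  move=> cf; split=> x; apply: continuous_comp; try exact: cf.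
    exact: continuous_cos.
  exact: continuous_sin.
move=> Cf; have [df Df] := Cf; have [Cc Cs] := IH _ (Ck_le Cf).
have dc x v := derive_comp_real v (df x) (is_derive_cos (f x)).
have ds x v := derive_comp_real v (df x) (is_derive_sin (f x)).
split; split=> [x|v].
- by have [] := dc x 0.
- have -> : (fun x => 'D_v (fun x => cos (f x) : R^o) x) =
            fun x => (-1) * sin (f x) * 'D_v f x.
    by apply/funext => x; rewrite mulN1r; have [] := dc x v.
  by apply: Ck_mul (Df v); apply: Ck_mul Cs; exact: Ck_cst.
- by have [] := ds x 0.
- have -> : (fun x => 'D_v (fun x => sin (f x) : R^o) x) =
            fun x => cos (f x) * 'D_v f x.
    by apply/funext => x; have [] := ds x v.
  exact: Ck_mul Cc (Df v).
Qed.

Lemma Ck_pair (W1 W2 : normedModType R) k (f : V -> W1) (g : V -> W2) :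
  Ck k f -> Ck k g -> Ck k (fun x => (f x, g x)).
Proof.
elim: k f g => [|k IH] f g; first exact: pair_continuous.
move=> [df Df] [dg Dg]; split=> [x|v]; first exact: differentiable_pair.
have -> : (fun x => 'D_v (fun x => (f x, g x)) x) =
          fun x => ('D_v f x, 'D_v g x).
  apply/funext => x; rewrite !deriveE ?diff_pair//.
  exact: differentiable_pair.
by apply: IH; [exact: Df|exact: Dg].
Qed.

End CkCalculus.

(** * A braid depends only on the set swept by the motion *)

Section SameTrace.
Local Open Scope classical_set_scope.
Local Open Scope ring_scope.
Local Open Scope quotient_scope.

Lemma within_pair (T U W : topologicalType) (A : set T) (f : T -> U) (g : T -> W) :
  {within A, continuous f} -> {within A, continuous g} ->
  {within A, continuous (fun x => (f x, g x))}.
Proof. exact: pair_continuous. Qed.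

Context {R : realType} (K : set R[i]).
Notation C := R[i].
Notation I := `[(0:R), 1]%classic.

(** The homotopy (s, t) |-> D'_1 (D'_s^-1 (D_s (g t))) leads from D'_1 o g to
    D_1 o g.  It avoids K because D_s and D'_s carry K to the same set.  The
    inverses of the D'_s are given as a family E', so as to have them jointly
    continuous in the time and the point. *)
Lemma same_trace_same_braid (n n' : nat) (m : 'I_n -> R -> C)
    (m' : 'I_n' -> R -> C) (D D' E' : R -> C -> C) (b b' : braid_diffeo K) :
  is_motion K m -> is_motion K m' ->
  (forall t, I t -> range (m^~ t) = range (m'^~ t)) ->
  realizes m D -> realizes m' D' -> D 1 = b -> D' 1 = b' ->
  {within I `*` disk, continuous (fun p : R * C => E' p.1 p.2)} ->
  (forall t y, I t -> disk y -> disk (E' t y) /\ D' t (E' t y) = y) ->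
  same_braid b b'.
Proof.
move=> [_ md _ mK _] [_ md' _ mK' _] mm' [dD cD D0 Dm] [dD' cD' D'0 D'm] D1 D'1.
move=> cE EK.
have [I0 I1] : I 0 /\ I 1 by rewrite /= !in_itv /= !lexx ler01.
have inj (F : R -> C -> C) t y z :
    diffeo disk (F t) -> disk y -> disk z -> F t y = F t z -> y = z.
  by move=> [[_ iF _] _ _] /mem_set dy /mem_set dz; exact: iF.
have KD t y : I t -> disk y -> range (m^~ t) (D t y) -> K y.
  move=> It dy [i _ mi]; rewrite -mK; exists i => //.
  apply: (inj D t) => //; [by have [] := dD t It|exact: md|].
  by rewrite Dm.
have KD' t y : I t -> K y -> range (m'^~ t) (D' t y).
  by move=> It; rewrite -{1}mK' => -[i _ <-]; exists i => //; rewrite D'm.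
have Dd t y : I t -> disk y -> disk (D t y).
  by move=> It; have [[[fD _ _] _ _] _] := dD t It; exact: fD.
have bu0 : disk_boundary (u0 : C).
  by rewrite /disk_boundary /u0 /= normrM normrN normr_nat normCi mulr1.
have du0 : disk (u0 : C) by rewrite /disk /= bu0.
apply/asboolP/funext => c; rewrite /pi1_map; apply/eqmodP => /=.
set g := repr c.
have gd t : I t -> disk (g t) by move=> /(loop_sub g)[].
rewrite homotopic_sym.
apply/asboolP; exists (fun p => b' (E' p.1 (D p.1 (g p.2)))); split=> /=.
(* The homotopy is continuous, as a composite of maps continuous on the
   relevant products. *)
- have c1 : {within I `*` I, continuous (fst : R * R -> R)}.
    by apply: continuous_subspaceT => p; exact: cvg_fst.
  have cg : {within I `*` I, continuous (fun p : R * R => g p.2)}.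
    apply: (@within_comp _ _ _ _ I snd g); last exact: loop_cts.
      by apply: continuous_subspaceT => p; exact: cvg_snd.
    by move=> [s t] [].
  have cDg : {within I `*` I, continuous (fun p : R * R => D p.1 (g p.2))}.
    apply: (within_comp (within_pair c1 cg) _ cD).
    by move=> [s t] [/= Is It]; split=> //=; exact: gd.
  have cED : {within I `*` I, continuous (fun p : R * R => E' p.1 (D p.1 (g p.2)))}.
    apply: (within_comp (within_pair c1 cDg) _ cE).
    by move=> [s t] [/= Is It]; split=> //=; apply: Dd => //; exact: gd.
  apply: (within_comp cED _ (@braid_within_continuous _ _ b')).
  by move=> [s t] [/= Is It]; apply: (EK _ _ _ _).1 => //; apply: Dd => //; exact: gd.
(* If D'_s^-1 (D_s (g t)) were in K, then D_s (g t) would be one of the points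
   of the motion at time s, and g t would be in K. *)
- move=> s t Is It; apply: braid_sub.
  have [gtd gtK] := loop_sub g It.
  have [Ed ED] := EK s _ Is (Dd _ _ Is gtd).
  split=> // /(KD' s _ Is); rewrite ED -mm'// => /KD hK.
  by apply: gtK; exact: hK.
- move=> t It; have gt := gd t It.
  have [Ed ED] := EK 0 _ I0 gt.
  by rewrite D0 ?inE// -[E' 0 _]D'0 ?inE// ED.
- move=> t It; have [_] := EK 1 _ I1 (Dd _ _ I1 (gd t It)).
  by rewrite -D'1 => ->; rewrite -D1.
- move=> s Is; rewrite loop_at0 loop_at1.
  have [dDs Dsu] := dD s Is; have [dDs' Dsu'] := dD' s Is.
  have -> : E' s (D s u0) = u0.
    rewrite Dsu ?inE//; have [Ed ED] := EK s _ Is du0.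
    by apply: (inj D' s) => //; rewrite ED Dsu' ?inE.
  by rewrite braid_u0.
Qed.

End SameTrace.
(** * The twist of the disk *)

Section Twist.
Local Open Scope classical_set_scope.
Local Open Scope ring_scope.
Local Open Scope quotient_scope.
Context {R : realType}.
Notation C := R[i].
Notation I := `[(0:R), 1]%classic.

Lemma cisD (a b : R) : cis (a + b) = cis a * cis b.
Proof.
by apply/eqP; rewrite eq_complex /= cosD sinD eqxx [X in _ == X]addrC !eqxx.
Qed.

Lemma cis0 : cis (0 : R) = 1.
Proof. by rewrite /cis cos0 sin0. Qed.

Lemma norm_cis (a : R) : `|cis a| = 1.
Proof. by rewrite normc_def /= cos2Dsin2 sqrtr1. Qed.

Lemma cis_neq0 (a : R) : cis a != 0.
Proof. by rewrite -normr_eq0 norm_cis oner_eq0. Qed.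

Definition sqnorm (y : C) : R := complex.Re y ^+ 2 + complex.Im y ^+ 2.

Lemma sqnorm_norm (y z : C) : `|y| = `|z| -> sqnorm y = sqnorm z.
Proof. by move=> yz; apply: (@complexI R); rewrite !add_Re2_Im2 yz. Qed.

(** Any function of |y|^2 that is smooth, 1 at |y| = 1 and 0 at |y| = 4 would do
    as the last factor; the affine one keeps all formulas polynomial. *)
Definition twist_angle (t : R) (y : C) : R := pi * t * ((16 - sqnorm y) / 15).

Definition twist (t : R) (y : C) : C := cis (twist_angle t y) * y.

Lemma norm_twist t y : `|twist t y| = `|y|.
Proof. by rewrite normrM norm_cis mul1r. Qed.

(** A twist preserves |y|, hence its own angle, so that angles add up under
    composition. *)
Lemma twist_inv t y : twist t (twist (- t) y) = y.
Proof.
rewrite {1}/twist /twist_angle (sqnorm_norm (norm_twist _ _)) /twist mulrA -cisD.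
by rewrite /twist_angle mulrN mulNr subrr cis0 mul1r.
Qed.

Lemma twistK t : cancel (twist t) (twist (- t)).
Proof. by move=> y; rewrite -[RHS](twist_inv (- t)) opprK. Qed.

Lemma twist0 y : twist 0 y = y.
Proof. by rewrite /twist /twist_angle mulr0 mul0r cis0 mul1r. Qed.

Lemma twist_boundary t y : disk_boundary y -> twist t y = y.
Proof.
move=> yb; have y4 : `|y| = `|4%:R : C| by rewrite normr_nat.
rewrite /twist /twist_angle (sqnorm_norm y4).
have -> : sqnorm (4%:R : C) = 16.
  by apply: (@complexI R); rewrite add_Re2_Im2 normr_nat rmorph_nat -natrX.
by rewrite subrr mul0r mulr0 cis0 mul1r.
Qed.

Lemma twist_unit t y : `|y| = 1 -> twist t y = cis (pi * t) * y.
Proof.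
move=> y1; have y1' : `|y| = `|1%:R : C| by rewrite normr_nat.
rewrite /twist /twist_angle (sqnorm_norm y1').
have -> : sqnorm (1%:R : C) = 1.
  by apply: (@complexI R); rewrite add_Re2_Im2 normr_nat rmorph1 expr1n.
have -> : (16 - 1) / 15 = 1 :> R by lra.
by rewrite mulr1.
Qed.

Lemma twist_origin t : twist t 0 = 0.
Proof. by rewrite /twist mulr0. Qed.

Lemma twist_smooth t k : Ck k (real_coords (twist t)).
Proof.
pose V := (R * R)%type : normedModType R.
have C1 : Ck k (fst : V -> R^o).
  by refine (@Ck_linear R V k fst _) => p; exact: cvg_fst.
have C2 : Ck k (snd : V -> R^o).
  by refine (@Ck_linear R V k snd _) => p; exact: cvg_snd.
pose th (p : V) : R^o := pi * t / 15 * (16 + (-1) * (p.1 * p.1 + p.2 * p.2)).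
have Cth : Ck k th.
  apply: Ck_mul; first exact: Ck_cst.
  apply: Ck_add; first exact: Ck_cst.
  apply: Ck_mul; first exact: Ck_cst.
  by apply: Ck_add; apply: Ck_mul.
have -> : real_coords (twist t) = fun p =>
    (cos (th p) * p.1 + (-1) * (sin (th p) * p.2) : R^o,
     cos (th p) * p.2 + sin (th p) * p.1 : R^o).
  apply/funext => p; rewrite /real_coords /=.
  have -> : twist_angle t (p.1 +i* p.2) = th p.
    by rewrite /twist_angle /sqnorm /th /=; ring.
  by rewrite mulN1r.
have [Cc Cs] := Ck_cos_sin Cth.
apply: Ck_pair; apply: Ck_add; last exact: Ck_mul.
- exact: Ck_mul.
- by apply: Ck_mul; [exact: Ck_cst|exact: Ck_mul].
- exact: Ck_mul.
Qed.

Lemma twist_diffeo t : diffeo disk (twist t).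
Proof.
have sm s : smooth_on disk (twist s).
  by exists (twist s) => // k; exact: twist_smooth.
split=> //; last by exists (twist (- t)) => // y _; exact: twistK.
split=> [y|y z _ _|y yd].
- by rewrite /disk /= norm_twist.
- exact: (can_inj (twistK t)).
- exists (twist (- t) y); last exact: twist_inv.
  by rewrite /disk /= norm_twist.
Qed.

Lemma twist_continuous : continuous (fun p : R * C => twist p.1 p.2).
Proof.
have cr : continuous (fun p : R * C => complex.Re p.2).
  by move=> p; apply: continuous_comp; [exact: cvg_snd|exact: Re_continuous].
have ci : continuous (fun p : R * C => complex.Im p.2).
  by move=> p; apply: continuous_comp; [exact: cvg_snd|exact: Im_continuous].
have ca : continuous (fun p : R * C => twist_angle p.1 p.2).
  move=> p; apply: cvgM; first by apply: cvgM; [exact: cvg_cst|exact: cvg_fst].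
  apply: cvgM; last exact: cvg_cst.
  apply: cvgB; first exact: cvg_cst.
  by apply: cvgD; rewrite expr2; apply: cvgM; (exact: cr) || exact: ci.
have cc : continuous (fun p : R * C => cos (twist_angle p.1 p.2)).
  by move=> p; apply: continuous_comp; [exact: ca|exact: continuous_cos].
have cs : continuous (fun p : R * C => sin (twist_angle p.1 p.2)).
  by move=> p; apply: continuous_comp; [exact: ca|exact: continuous_sin].
have -> : (fun p : R * C => twist p.1 p.2) =
    (fun q : R * R => q.1 +i* q.2) \o (fun p : R * C =>
      (cos (twist_angle p.1 p.2) * complex.Re p.2 -
         sin (twist_angle p.1 p.2) * complex.Im p.2,
       cos (twist_angle p.1 p.2) * complex.Im p.2 +
         sin (twist_angle p.1 p.2) * complex.Re p.2)).
  by apply/funext => -[t [x y]].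
move=> p; apply: continuous_comp; last exact: complex_continuous.
apply: pair_continuous => q.
  by apply: cvgB; apply: cvgM; [exact: cc|exact: cr|exact: cs|exact: ci].
by apply: cvgD; apply: cvgM; [exact: cc|exact: ci|exact: cs|exact: cr].
Qed.

End Twist.

(** * The half turn and the fibers of the curve *)

Section HalfTurn.
Local Open Scope classical_set_scope.
Local Open Scope ring_scope.
Local Open Scope quotient_scope.
Context {R : realType}.
Notation C := R[i].
Notation I := `[(0:R), 1]%classic.
Notation K := (fiber curve (1 : C)).

Lemma half_turn0 i : half_turn i (0 : R) = [tuple 0; 1; -1; 'i; - 'i]`_i.
Proof. by rewrite /half_turn mulr0 cis0 mul1r. Qed.

Lemma half_turn_twist i (t : R) : twist t (half_turn i 0) = half_turn i t.
Proof.
rewrite half_turn0 /half_turn.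
case: i => -[|[|[|[|[|//]]]]] /= _; first by rewrite twist_origin mulr0.
all: by rewrite twist_unit// ?normrN ?normr1 ?normCi.
Qed.

Lemma half_turn_inj (t : R) : injective (half_turn^~ t).
Proof.
move=> i j /(mulfI (cis_neq0 _)) ij; apply/val_inj/eqP.
rewrite -(@nth_uniq _ 0 [tuple 0; 1; -1; 'i; - 'i : C]) ?size_tuple ?ltn_ord //.
  by apply/eqP.
have i0 : 'i != 0 :> C by exact: neq0Ci.
have n1 : 1 != -1 :> C by rewrite -addr_eq0 -mulr2n pnatr_eq0.
have i1 : 1 != 'i :> C.
  by apply: contra n1 => /eqP e; rewrite -sqrCi -e expr1n.
have iN1 : -1 != 'i :> C.
  by apply: contra n1 => /eqP e; rewrite -sqrCi -e sqrrN expr1n.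
have iNi : 'i != - 'i :> C by rewrite -addr_eq0 -mulr2n mulrn_eq0.
rewrite /= !inE !negb_or ![0 == _]eq_sym oner_eq0 !oppr_eq0 oner_eq0 i0 n1 iNi.
by rewrite -eqr_oppLR eqr_opp i1 iN1.
Qed.

(** With c = exp (pi i t), the equation y^2 = - c^2 has the solutions c i and
    - c i, and y^2 = c^2 has the solutions c and - c. *)
Lemma half_turn_range (t : R) : range (half_turn^~ t) = fiber curve (cis (2 * pi * t)).
Proof.
have -> : cis (2 * pi * t) = cis (pi * t) ^+ 2 :> C.
  by rewrite expr2 -cisD; congr cis; ring.
set c := cis _.
have normc : `|c| = 1 by exact: norm_cis.
apply/seteqP; split=> y.
  move=> [i _ <-]; split=> /=.
  - by rewrite normrX normc expr1n.
  - rewrite -half_turn_twist norm_twist half_turn0.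
    case: i => -[|[|[|[|[|//]]]]] /= _;
      by rewrite ?normrN ?normr0 ?normCi ?normr1 ?ler0n ?ler1n.
  - rewrite /half_turn -/c; case: i => -[|[|[|[|[|//]]]]] /= _.
    + by rewrite mulr0 !mul0r.
    + by rewrite mulr1 subrr mulr0.
    + by rewrite mulrN1 sqrrN subrr mulr0.
    + by rewrite exprMn sqrCi mulrN1 addNr mulr0 mul0r.
    + by rewrite mulrN sqrrN exprMn sqrCi mulrN1 addNr mulr0 mul0r.
move=> [_ _ /= /eqP]; rewrite !mulf_eq0 -orbA => /or3P[/eqP->|/eqP yc|].
- by exists ord0 => //; rewrite /half_turn mulr0.
- have /eqP : y ^+ 2 = (c * 'i) ^+ 2.
    by rewrite exprMn sqrCi mulrN1; apply/eqP; rewrite -addr_eq0 yc.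
  rewrite eqf_sqr => /orP[]/eqP->.
    by exists (inord 3) => //; rewrite /half_turn inordK.
  by exists (inord 4) => //; rewrite /half_turn inordK//= mulrN.
- rewrite subr_eq0 eqf_sqr => /orP[]/eqP->.
    by exists (inord 1) => //; rewrite /half_turn inordK//= mulr1.
  by exists (inord 2) => //; rewrite /half_turn inordK//= mulrN1.
Qed.

Lemma half_turn_start : range (half_turn^~ (0 : R)) = K.
Proof. by rewrite half_turn_range mulr0 cis0. Qed.

Lemma half_turn_end : range (half_turn^~ (1 : R)) = K.
Proof.
rewrite half_turn_range mulr1 mulr_natl; congr (fiber _ _).
by rewrite /cis cos2pi sin2pi.
Qed.

Lemma half_turn_motion : is_motion K (@half_turn R).
Proof.
split=> [i|i t _|t _||].
- apply: continuous_subspaceT.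
  have -> : half_turn i = (fun p : R * C => twist p.1 p.2) \o
                          (fun t => (t, half_turn i 0)).
    by apply/funext => t /=; rewrite half_turn_twist.
  move=> t; apply: continuous_comp; last exact: twist_continuous.
  by apply: pair_continuous => s; [exact: cvg_id|exact: cvg_cst].
- by have [] : fiber curve (cis (2 * pi * t)) (half_turn i t)
    by rewrite -half_turn_range; exists i.
- exact: half_turn_inj.
- exact: half_turn_start.
- exact: half_turn_end.
Qed.

Lemma twist1_fiber (y : C) : disk y -> K (twist 1 y) <-> K y.
Proof.
move=> _; rewrite -{1}half_turn_end -half_turn_start; split=> -[i _].
  by rewrite -half_turn_twist => /(can_inj (twistK 1)) <-; exists i.
by move=> <-; exists i => //; rewrite half_turn_twist.
Qed.

Definition half_twist : braid_diffeo K :=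
  BraidDiffeo (twist_diffeo 1) twist1_fiber
    (fun y yb => twist_boundary 1 (set_mem yb)).

Lemma twist_realizes : realizes (@half_turn R) twist.
Proof.
split=> [t _||y _|i t _].
- by split=> [|y /set_mem]; [exact: twist_diffeo|exact: twist_boundary].
- exact/continuous_subspaceT/twist_continuous.
- exact: twist0.
- exact: half_turn_twist.
Qed.

Lemma induced_braid_half_turn :
  induced_braid (@half_turn R) (\pi_(braid R K) half_twist).
Proof.
split; first exact: half_turn_motion.
by exists twist, half_twist; split=> //; exact: twist_realizes.
Qed.

(** This serves both for the half turn itself and for every motion formed by the
    points of the curve, in whatever order they are numbered. *)
Lemma induced_braid_same_trace n (m : 'I_n -> R -> C) (b : braid R K) :
  (forall t, I t -> range (m^~ t) = range (half_turn^~ t)) ->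
  induced_braid m b -> b = \pi_(braid R K) half_twist.
Proof.
move=> mh [mm [D [beta [rD D1 ->]]]]; apply/eqmodP => /=.
apply: (same_trace_same_braid (D' := twist) (E' := fun t => twist (- t))
  mm half_turn_motion mh rD twist_realizes D1) => //.
  apply: continuous_subspaceT.
  have -> : (fun p : R * C => twist (- p.1) p.2) =
    (fun p : R * C => twist p.1 p.2) \o (fun p => (- p.1, p.2)) by [].
  move=> p; apply: continuous_comp; last exact: twist_continuous.
  apply: pair_continuous => q; last exact: cvg_snd.
  by apply: cvgN; exact: cvg_fst.
by move=> t y _ yd; split; [rewrite /disk /= norm_twist|exact: twist_inv].
Qed.

End HalfTurn.

Theorem theorem4p6 (R : realType) :
  exists b : braid R (fiber curve (1%R : R[i])),
    (forall b', local_braid_monodromy 5 curve b' <-> b' = b) /\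
    (forall b', induced_braid half_turn b' <-> b' = b).
Proof.
exists (\pi_(braid R (fiber curve 1%R))%qT half_twist); split=> b'; split.
- move=> [m mS]; apply: induced_braid_same_trace => t It.
  by rewrite mS// half_turn_range.
- move=> ->; exists (@half_turn R); last exact: induced_braid_half_turn.
  by move=> t _; exact: half_turn_range.
- exact: induced_braid_same_trace.
- by move=> ->; exact: induced_braid_half_turn.
Qed.
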